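(* Let $k=\mathbb{R}$ or $k=\mathbb{C}$, and let $(\mathsf{A},\|\cdot\|)$ be a commutative normed $k$-algebra with a unit. Then $\mathsf{A}$, as a topological ring under the topology induced by the norm, is rigid.
   Context: In a normed algebra the norm is assumed sub-multiplicative: $\|xy\|\le\|x\|\,\|y\|$ (completeness is not assumed). For a (Hausdorff) topological commutative unital ring $(R,\tau)$ and a set $X$, $(R,\tau)^X$ is the $R$-module $R^X$ of all maps $X\to R$ with the product topology, $R^{(X)}$ is the submodule of finitely supported maps, and $((R,\tau)^X)'$ is the $R$-module of continuous $R$-linear maps $(R,\tau)^X\to(R,\tau)$. $(R,\tau)$ is rigid if for every set $X$ the $R$-linear map $\lambda_X\colon R^{(X)}\to((R,\tau)^X)'$, $\lambda_X(p)(f)=\sum_{x\in X}p(x)f(x)$, is an isomorphism. *)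

(* Defs.v *)
From HB Require Import structures.
From mathcomp Require Import all_boot all_order all_algebra.
From mathcomp Require Import all_classical all_reals all_analysis.
From mathcomp Require Import finmap complex.

Set Implicit Arguments.
Unset Strict Implicit.
Unset Printing Implicit Defensive.

Import Order.TTheory GRing.Theory Num.Theory.

Local Open Scope classical_set_scope.
Local Open Scope ring_scope.

(* Rings are [ComPzRing]s, so that the zero ring is allowed. *)
HB.mixin Record TopologicalZmodule_isHausdorffTopComRing R
    & TopologicalZmodule R & GRing.ComPzRing R := {
  ring_mul_continuous : continuous (fun x : R * R => x.1 * x.2);
  ring_hausdorff : hausdorff_space R
}.

#[short(type="hausdorffTopComRingType")]
HB.structure Definition HausdorffTopComRing :=
  { R of TopologicalZmodule R & GRing.ComPzRing R
       & TopologicalZmodule_isHausdorffTopComRing R }.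

(* The ring operations are fields of the mixin, rather than inherited from
   [GRing.ComPzRing], because the hierarchy already has [Num.NumDomain] as the
   join of rings and normed modules; the ring instance comes right after.
   The norm is [K]-valued: for [K = C] it takes its values among the
   nonnegative elements of [C].  Neither [`|1| = 1] nor [1 != 0] nor
   completeness is required. *)
HB.mixin Record NormedModule_isComNormedAlgebra (K : numFieldType) A
    & NormedModule K A := {
  normed_one : A;
  normed_mul : A -> A -> A;
  normed_mulrA : associative normed_mul;
  normed_mulrC : commutative normed_mul;
  normed_mul1r : left_id normed_one normed_mul;
  normed_mulrDl : left_distributive normed_mul +%R;
  normed_scalerAl : forall (k : K) (x y : A),
    k *: normed_mul x y = normed_mul (k *: x) y;
  normed_mul_le : forall x y : A, `|normed_mul x y| <= `|x| * `|y|
}.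

#[short(type="comNormedAlgType")]
HB.structure Definition ComNormedAlgebra (K : numFieldType) :=
  { A of NormedModule K A & NormedModule_isComNormedAlgebra K A }.

Section ComNormedAlgebra_topology.
Variables (K : numFieldType) (A : comNormedAlgType K).

HB.instance Definition _ :=
  GRing.Zmodule_isComPzRing.Build A (@normed_mulrA K A) (@normed_mulrC K A)
    (@normed_mul1r K A) (@normed_mulrDl K A).

Lemma normrM_le (x y : A) : `|x * y| <= `|x| * `|y|.
Proof. exact: normed_mul_le. Qed.

Lemma normed_mul_continuous : continuous (fun x : A * A => x.1 * x.2).
Proof.
move=> [/= a b]; apply/cvgrPdist_lt => _/posnumP[e]; near +oo_K => M.
near=> x y => /=; have M0 : 0 < M by [].
rewrite (@distm_lt_split _ _ (a * y)) // -?(mulrBr, mulrBl).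
  rewrite (le_lt_trans (normrM_le _ _))//.
  rewrite (@le_lt_trans _ _ (M * `|b - y|)) ?ler_wpM2r -?ltr_pdivlMl//.
  by near: y; apply: cvgr_dist_lt; rewrite // mulr_gt0 ?invr_gt0.
rewrite (le_lt_trans (normrM_le _ _))//.
rewrite (@le_lt_trans _ _ (`|a - x| * M)) ?ler_wpM2l -?ltr_pdivlMr//.
  by near: y; near: M; apply: cvg_bounded (@cvg_refl _ _).
by near: x; apply: cvgr_dist_lt; rewrite // divr_gt0.
Unshelve. all: by end_near. Qed.

HB.instance Definition _ :=
  TopologicalZmodule_isHausdorffTopComRing.Build A
    normed_mul_continuous (@norm_hausdorff K A).

End ComNormedAlgebra_topology.

Section HausdorffTopComRing_theory.
Variables (R : hausdorffTopComRingType) (T : topologicalType).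
Implicit Types f g : T -> R.

Lemma top_continuousD f g :
  continuous f -> continuous g -> continuous (fun x => f x + g x).
Proof.
move=> cf cg x; apply: (@continuous_comp _ _ _ (fun x => (f x, g x))
  (fun z : R * R => z.1 + z.2)); last exact: add_continuous.
by apply: cvg_pair => /=; [exact: cf|exact: cg].
Qed.

Lemma top_continuousM f g :
  continuous f -> continuous g -> continuous (fun x => f x * g x).
Proof.
move=> cf cg x; apply: (@continuous_comp _ _ _ (fun x => (f x, g x))
  (fun z : R * R => z.1 * z.2)); last exact: ring_mul_continuous.
by apply: cvg_pair => /=; [exact: cf|exact: cg].
Qed.

End HausdorffTopComRing_theory.

Section Rigid.
Variable R : hausdorffTopComRingType.

Definition power (X : Type) := X -> R^o.

HB.instance Definition _ (X : Type) :=
  GRing.Lmodule.copy (power X) (X -> R^o).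
HB.instance Definition _ (X : Type) :=
  Topological.copy (power X) {ptws X -> R}.

Variable X : Type.

Definition finitely_supported : {pred power X} :=
  fun p => `[< finite_set [set x | p x != 0] >].

Lemma finitely_supported_submod : submod_closed finitely_supported.
Proof.
split=> [|a p q]; rewrite !unfold_in.
  apply/asboolP; rewrite (_ : [set _ | _] = set0)//.
  by apply/seteqP; split=> x //=; rewrite eqxx.
move=> /asboolP fp /asboolP fq; apply/asboolP.
apply: (sub_finite_set (B := [set x | p x != 0] `|` [set x | q x != 0])).
  move=> x /=; apply: contra_neqP => /not_orP[/negP/negPn/eqP px].
  move=> /negP/negPn/eqP qx.
  by rewrite -[LHS]/(a *: p x + q x) px qx scaler0 addr0.
by rewrite finite_setU.
Qed.

HB.instance Definition _ :=
  GRing.isSubmodClosed.Build R (power X) finitely_supported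
    finitely_supported_submod.

Definition finsupp := {p : power X | p \in finitely_supported}.
HB.instance Definition _ := SubChoice.on finsupp.
HB.instance Definition _ :=
  [SubChoice_isSubLmodule of finsupp by <:].

Definition continuous_linear : {pred power X -> R^o} :=
  fun l => `[< linear l /\ continuous (l : power X -> R) >].

Lemma continuous_linear_submod : submod_closed continuous_linear.
Proof.
split=> [|a l m]; rewrite !unfold_in.
  apply/asboolP; split=> [b f g|]; last exact: cst_continuous.
  by rewrite /= scaler0 addr0.
move=> /asboolP[linl contl] /asboolP[linm contm]; apply/asboolP; split.
  move=> b f g; rewrite -![(a *: l + m) _]/(a *: l _ + m _) linl linm.
  by rewrite !scalerDr !scalerA (mulrC a b) addrACA.
apply: (@top_continuousD R (power X) (fun f => a * l f) m) => //.
apply: (@top_continuousM R (power X) (cst a) l) => //.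
exact: cst_continuous.
Qed.

HB.instance Definition _ :=
  GRing.isSubmodClosed.Build R (power X -> R^o) continuous_linear
    continuous_linear_submod.

Definition cont_dual := {l : power X -> R^o | l \in continuous_linear}.
HB.instance Definition _ := SubChoice.on cont_dual.
HB.instance Definition _ := [SubChoice_isSubLmodule of cont_dual by <:].

(* [{classic X}] is [X] with a choice structure, required by the finitely
   supported sum. *)
Definition lambda_fun (p : finsupp) : power X -> R^o :=
  fun f => \sum_(x \in [set: {classic X}]) val p x * f x.

Lemma lambda_funE (p : finsupp) (S : {fset {classic X}}) :
  (forall x : {classic X}, val p x != 0 -> x \in S) ->
  lambda_fun p = fun f => \sum_(x <- S) val p x * f x.
Proof.
move=> pS; apply/funext => f; rewrite /lambda_fun.
apply: fsbigTE => x; apply: contraNeq => pxf; apply: pS.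
by apply: contra_neq pxf => ->; rewrite mul0r.
Qed.

Lemma finsupp_fset (p : finsupp) :
  exists S : {fset {classic X}}, forall x : {classic X}, val p x != 0 -> x \in S.
Proof.
have /asboolP fp : val p \in finitely_supported := valP p.
have /finite_fsetP[S pS] :
  finite_set ([set x | val p x != 0] : set {classic X}) by exact: fp.
exists S => x px.
by have : [set` S] x by rewrite -pS.
Qed.

Lemma lambda_fun_dual (p : finsupp) : lambda_fun p \in continuous_linear.
Proof.
have [S /lambda_funE ->] := finsupp_fset p.
rewrite unfold_in; apply/asboolP; split.
  move=> a f g; rewrite scaler_sumr -big_split/=; apply: eq_bigr => x _.
  by rewrite -[(a *: f + g) x]/(a * f x + g x) mulrDr mulrCA.
elim: (enum_fset S) => [|x s IHs].
  by under eq_fun do rewrite big_nil; exact: cst_continuous.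
under eq_fun do rewrite big_cons.
apply: (@top_continuousD R (power X) (fun f => val p x * f x)) => //.
apply: (@top_continuousM R (power X) (cst (val p x)) (fun f => f x)).
  exact: cst_continuous.
exact: (@proj_continuous {classic X} (fun=> R) x).
Qed.

Definition lambda (p : finsupp) : cont_dual :=
  Sub (lambda_fun p) (lambda_fun_dual p).

Lemma lambda_linear : linear lambda.
Proof.
move=> a p q; apply/val_inj => /=.
have [S pS] := finsupp_fset p; have [T qT] := finsupp_fset q.
have pU (x : {classic X}) : val p x != 0 -> x \in (S `|` T)%fset.
  by move=> /pS xS; rewrite in_fsetU xS.
have qU (x : {classic X}) : val q x != 0 -> x \in (S `|` T)%fset.
  by move=> /qT xT; rewrite in_fsetU xT orbT.
have pqU (x : {classic X}) : val (a *: p + q) x != 0 -> x \in (S `|` T)%fset.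
  apply: contraR => xU; have px : val p x = 0 by apply/eqP/(contraNT (pU x)).
  have qx : val q x = 0 by apply/eqP/(contraNT (qU x)).
  rewrite linearP /= -[(a *: val p + val q) x]/(a * val p x + val q x).
  by rewrite px qx mulr0 addr0.
rewrite (lambda_funE pU) (lambda_funE qU) (lambda_funE pqU).
apply/funext => f; rewrite linearP.
rewrite -[RHS]/(a * (\sum_(x <- (S `|` T)%fset) val p x * f x) +
  \sum_(x <- (S `|` T)%fset) val q x * f x).
rewrite mulr_sumr -big_split/=; apply: eq_bigr => x _.
by rewrite -[(a *: val p + val q) x]/(a * val p x + val q x) mulrDl mulrA.
Qed.

HB.instance Definition _ :=
  GRing.isLinear.Build R finsupp cont_dual *:%R lambda lambda_linear.

End Rigid.

Definition rigid (R : hausdorffTopComRingType) :=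
  forall X : Type, bijective (@lambda R X).

(* Main.v *)
(* If some neighborhood of 0 in R contains no nonzero ideal, then every
   continuous linear l : R^X -> R vanishes on all f that are zero on some
   finite F: by continuity l maps all these f, which form a submodule, into
   that neighborhood.  Hence l is determined by its values on the unit vectors
   e_x with x in F, and l e_x = 0 for x outside F.  In a normed algebra the
   open unit ball contains no nonzero ideal, since it contains no line. *)
Require Import Defs.
From mathcomp Require Import all_boot all_order all_algebra.
From mathcomp Require Import all_classical all_reals all_analysis.
From mathcomp Require Import finmap complex.

Set Implicit Arguments.
Unset Strict Implicit.
Unset Printing Implicit Defensive.

Import Order.TTheory GRing.Theory Num.Theory.

Local Open Scope classical_set_scope.
Local Open Scope ring_scope.

(** The sets of maps agreeing with [f] on a finite set form a filter base, and the filter it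
    generates refines the neighborhoods of [f] in the product topology. *)
Lemma nbhs_ptws_finite (X : Type) (T : topologicalType) (f : {ptws X -> T})
    (U : set {ptws X -> T}) :
  nbhs f U -> exists2 F : set X, finite_set F &
    forall g : X -> T, (forall x, F x -> g x = f x) -> U g.
Proof.
pose agree (F : set X) := [set g : X -> T | forall x, F x -> g x = f x].
pose G := filter_from (@finite_set X) agree.
suff Gf : G --> f by move=> /Gf[F]; exists F.
have GF : Filter G.
  apply: filter_from_filter; first by exists set0; exact: finite_set0.
  move=> E F fE fF; exists (E `|` F); first by rewrite finite_setU.
  by move=> g gf; split=> x Fx; apply: gf; [left|right].
(* The product topology is the supremum of the topologies induced by the evaluations, so one
   coordinate [x] can be treated at a time. *)
apply/cvg_sup => x V [_ [[W Wop <-]] Wf /filterS]; apply.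
exists [set x]; first exact: finite_set1.
by move=> g gf; rewrite /preimage /= gf.
Qed.

Section RigidityCriterion.
Variable R : hausdorffTopComRingType.

Definition unit_vector (X : Type) (x : X) : power R X :=
  fun y => (`[< x = y >])%:R.

Lemma unit_vectorC (X : Type) (x y : X) : unit_vector x y = unit_vector y x.
Proof. by rewrite /unit_vector (_ : (x = y) = (y = x))//; apply/propext. Qed.

Lemma sum_unit_vector (X : Type) (S : {fset {classic X}}) (c : X -> R)
    (x : {classic X}) :
  x \in S -> \sum_(y <- S) c y * unit_vector (y : X) x = c x.
Proof.
move=> xS; rewrite (big_fsetD1 x)//= big1_fset => [|y].
  by rewrite /unit_vector asboolT// mulr1 addr0.
rewrite in_fsetD1 => /andP[/eqP yx _] _.
by rewrite /unit_vector asboolF ?mulr0.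
Qed.

Lemma lambda_unit_vector (X : Type) (p : Defs.finsupp R X) (x : X) :
  val (lambda p) (unit_vector x) = val p x.
Proof.
have [S pS] := finsupp_fset p.
(* Adjoining [x] to [S] makes it an index of the sum even when [p] vanishes there. *)
rewrite /= (@lambda_funE _ _ p ((x : {classic X}) |` S)%fset); last first.
  by move=> y /pS; rewrite in_fsetU => ->; rewrite orbT.
under eq_bigr do rewrite unit_vectorC.
by apply: sum_unit_vector; rewrite fset1U1.
Qed.

Lemma lambda_inj (X : Type) : injective (@lambda R X).
Proof.
move=> p q pq; apply/val_inj/funext => x.
by rewrite -!lambda_unit_vector pq.
Qed.

Hypothesis no_small_ideal : exists2 U : set R, nbhs 0 U &
  forall y, (forall a, U (a * y)) -> y = 0.

Lemma cont_dual_vanish (X : Type) (l : cont_dual R X) :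
  exists2 F : set X, finite_set F &
    forall f : power R X, (forall x, F x -> f x = 0) -> val l f = 0.
Proof.
have /asboolP[linl contl] : val l \in continuous_linear (X:=X) := valP l.
have [U U0 Uid] := no_small_ideal.
have l0 : val l 0 = 0.
  by have := linl (-1) 0 0; rewrite !scaleN1r oppr0 addr0 addNr.
have lZ a f : val l (a *: f) = a * val l f.
  by have := linl a f 0; rewrite l0 !addr0.
have /nbhs_ptws_finite[F finF FU] : nbhs (0 : power R X) (val l @^-1` U).
  by apply: (contl 0); rewrite l0.
(* Each [a *: f] vanishes on [F] too, so [U] contains every multiple of [val l f]. *)
exists F => // f f0; apply: Uid => a; rewrite -lZ; apply: FU => x Fx.
by rewrite -[LHS]/(a * f x) f0// mulr0.
Qed.

(** The coefficients of the preimage are the values of [l] at the unit vectors; they vanish outside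
    [F], and [l] does not see the change when [f] is cut off outside [F]. *)
Lemma lambda_surj (X : Type) (l : cont_dual R X) :
  exists p : Defs.finsupp R X, lambda p = l.
Proof.
have [F finF lF] := cont_dual_vanish l.
have /asboolP[linl _] : val l \in continuous_linear (X:=X) := valP l.
pose p0 : power R X := fun x => val l (unit_vector x).
have p0F x : ~ F x -> p0 x = 0.
  move=> Fx; apply: lF => y Fy; rewrite /unit_vector asboolF// => xy.
  by apply: Fx; rewrite xy.
have p0fin : p0 \in finitely_supported (X:=X).
  apply/asboolP; apply: sub_finite_set finF => x /= /eqP p0x.
  by apply: contrapT => /p0F.
pose p : Defs.finsupp R X := Sub p0 p0fin.
exists p; apply/val_inj/funext => f.
have /finite_fsetP[S FS] : finite_set (F : set {classic X}) by exact: finF.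
have pS (x : {classic X}) : val p x != 0 -> x \in S.
  move=> /eqP px; have : F x by apply: contrapT => /p0F.
  by rewrite FS.
rewrite /= (lambda_funE pS).
have lsum (s : seq {classic X}) :
    val l (\sum_(x <- s) f x *: unit_vector (x : X)) =
    \sum_(x <- s) f x * val l (unit_vector (x : X)).
  (* The empty sum is the zero map, which vanishes on [F], so [lF] applies to it. *)
  elim: s => [|x s IHs]; first by rewrite !big_nil lF.
  by rewrite !big_cons linl IHs.
(* Since [S] enumerates [F], this is [f] set to zero outside [F]. *)
set h := \sum_(x <- S) f x *: unit_vector (x : X).
have hE x : F x -> h x = f x.
  move=> Fx; have xS : (x : {classic X}) \in S.
    by have : [set` S] x by rewrite -FS.
  have -> : h x = \sum_(y <- S) f y * unit_vector (y : X) x.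
    rewrite /h; elim: (enum_fset S) => [|y s IHs]; first by rewrite !big_nil.
    by rewrite !big_cons -IHs.
  exact: (sum_unit_vector f xS).
suff -> : val l f = \sum_(x <- S) f x * val l (unit_vector (x : X)).
  by apply: eq_bigr => x _; rewrite mulrC.
have fh0 : val l (f - h) = 0.
  by apply: lF => x Fx; rewrite -[LHS]/(f x - h x) hE// subrr.
have := linl 1 h (f - h).
by rewrite fh0 addr0 !scale1r addrC subrK => ->; exact: lsum.
Qed.

Lemma rigid_of_no_small_ideal : rigid R.
Proof.
move=> X; have [mu muK] := choice (@lambda_surj X).
exists mu; last exact: muK.
(* A right inverse of an injective map is also a left inverse. *)
exact: inj_can_sym muK (@lambda_inj X).
Qed.

End RigidityCriterion.

Lemma comNormedAlg_rigid (K : numFieldType) (A : comNormedAlgType K) : rigid A.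
Proof.
apply: rigid_of_no_small_ideal; exists (ball (0 : A) 1).
  exact: nbhsx_ballx.
move=> y yU; apply/eqP; apply: contraT => y0.
(* This multiplier turns [y] into a vector of norm exactly 1, which lies outside the open unit
   ball. *)
have := yU (`|y|^-1 *: (1 : A)).
rewrite -[_ * y]normed_scalerAl [normed_mul _ _]mul1r.
rewrite -ball_normE /= sub0r normrN normrZ normfV normr_id mulVf ?ltxx//.
by rewrite normr_eq0.
Qed.

Theorem lemma19 (R : realType) :
  (forall A : comNormedAlgType R, rigid A) /\
  (forall A : comNormedAlgType R[i], rigid A).
Proof. by split=> A; exact: comNormedAlg_rigid. Qed.
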